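(* Let $k$ be an algebraically closed field of characteristic zero, let $S=k[x_1,x_2,x_3]$, and let $d>2$ be an integer. Then \[ \max\left\{\mathrm{rk}(M): M\in S_d \text{ is a monomial}\right\}= \begin{cases}\left(\dfrac{d+1}{2}\right)^2 & \text{if } d \text{ is odd},\\[2ex] \dfrac{d}{2}\left(\dfrac{d}{2}+1\right) & \text{if } d\text{ is even},\end{cases} \] and this number is asymptotically $\frac{3}{2}$ of the rank of the generic degree $d$ form in three variables, i.e. \[\max\left\{\mathrm{rk}(M): M\in S_d \text{ is a monomial}\right\}\simeq \frac{3}{2}\left\lceil \frac{\binom{d+2}{2}}{3}\right\rceil\] for $d\gg 0$, meaning that the ratio of the two sides tends to $1$ as $d\to\infty$.
   Context: For a homogeneous polynomial (form) $F$ of degree $d$ in $S=k[x_1,x_2,x_3]$, the Waring rank $\mathrm{rk}(F)$ is the least integer $s$ for which there exist linear forms $L_1,\ldots,L_s\in S$ such that $F=\sum_{i=1}^s L_i^d$. $S_d$ denotes the space of degree $d$ forms in $S$. The rank of the generic degree $d$ form is the value of $\mathrm{rk}$ on a nonempty Zariski-open subset of $S_d$; by the Alexander–Hirschowitz theorem, in three variables and for $d\gg 0$, it equals $\left\lceil \binom{d+2}{2}/3\right\rceil$. *)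

(* Defs.v *)
From HB Require Import structures.
From mathcomp Require Import all_boot all_order all_algebra.
From mathcomp Require Import boolp.
From mathcomp Require Import mpoly.

Set Implicit Arguments.
Unset Strict Implicit.
Unset Printing Implicit Defensive.

Import GRing.Theory.
Local Open Scope ring_scope.

Section WaringRank.
Variable k : fieldType.

(* Linear forms are the elements of S_1, so L i = 0 is allowed; this does not
   affect the minimal number of summands. *)
Definition sum_of_powers (d : nat) (F : {mpoly k[3]}) (s : nat) : Prop :=
  exists L : 'I_s -> {mpoly k[3]},
    (forall i, L i \is 1.-homog) /\ F = \sum_(i < s) L i ^+ d.

(* The value 0 in the second branch is a dummy: over an algebraically closed
   field of characteristic 0, every form of degree d > 0 is a sum of d-th
   powers. *)
Definition rk (d : nat) (F : {mpoly k[3]}) : nat :=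
  match pselect (exists s, `[< sum_of_powers d F s >]) with
  | left ex => ex_minn ex
  | right _ => 0%N
  end.

End WaringRank.

Definition monomial (d : nat) := {m : 'X_{1..3 < d.+1} | mdeg m == d}.

Definition max_monomial_rk (k : fieldType) (d : nat) : nat :=
  \max_(m : monomial d) rk d ('X_[val m] : {mpoly k[3]}).

Section GenericRank.
Variables (k : fieldType) (d : nat).

(* Coefficients of a form of degree d: affine coordinates on S_d. *)
Definition coords (F : {mpoly k[3]}) (i : 'I_#|{: monomial d}|) : k :=
  F@_(val (enum_val i)).

(* Only the values of U on S_d matter. *)
Definition Zariski_open (U : {mpoly k[3]} -> Prop) : Prop :=
  exists I : {mpoly k[#|{: monomial d}|]} -> Prop,
    forall F : {mpoly k[3]}, F \is d.-homog ->
      (U F <-> exists2 P, I P & P.@[coords F] != 0).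

Definition is_generic_rk (r : nat) : Prop :=
  exists U : {mpoly k[3]} -> Prop,
    [/\ Zariski_open U,
        exists2 F, F \is d.-homog & U F
      & forall F, F \is d.-homog -> U F -> rk d F = r].

End GenericRank.

(* Main.v *)
Require Import Defs.
From mathcomp Require Import all_boot all_order all_algebra.
From mathcomp Require Import cyclotomic separable cyclic.
From mathcomp Require Import boolp ring lra zify.
From mathcomp Require mpoly.

(** A linear form with coefficient vector p in k^3 has a d-th power whose
    coefficient at x^m is c_m p^m, where c_m is a multinomial coefficient and
    p^m the value of the monomial x^m at p.  Hence F is a sum of s d-th powers
    exactly when F_m = c_m (p_1^m + ... + p_s^m) for s suitable points: up to
    the nonzero factors c_m, its coefficients are the moments of s points
    ([sum_of_powersP]).  Both the ranks of monomials and the generic rank are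
    read off from moments.

    Monomials.  Let m have exponents a <= b <= c.  If a > 0, the points
    (1, e, f) with e^(b+1) = f^(c+1) = 1, weighted by e f, have all their
    moments of degree a + b + c equal to zero except the one at m, by
    orthogonality of roots of unity; if a = 0, the points (0, 1, f) suffice.
    So the rank is at most (b+1)(c+1), respectively c+1
    ([rk_monomial_le]).  Conversely, for the monomial x y^b z^c fewer than
    (b+1)(c+1) points admit a nonzero polynomial with monomials y^j z^l,
    j <= b, l <= c, vanishing at all the points (y/x, z/x) with x <> 0.
    Multiplying its homogenization by x and by y^(b-j) z^(c-l), where
    y^j z^l is one of its leading monomials, gives a form of degree d that
    vanishes at every point and in which x y^b z^c is the only monomial with
    a nonzero moment; this is absurd ([rank_monomial_ge]).  The maximum of
    (b+1)(c+1) for b + c = d - 1 is the stated value, and it dominates all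
    the other upper bounds ([max_monomial_rkE]).

    Generic rank.  The ratio depends only on the leading term d^2/6 of the
    generic rank r, which two elementary arguments provide
    ([generic_rk_bounds]).  From below, sums of r powers depend on 3r
    parameters, and more than 3r polynomials in 3r variables are
    algebraically dependent ([algebraic_dependence]); so 3r is at least the
    number binomial(d+2, 2) of monomials.  From above, the map sending s
    points to their moments is dominant as soon as its differential is onto at
    one s-tuple, that is, as soon as no nonzero form of degree d is singular
    at all these s points ([dominant_of_jacobian], [moment_map_dominant]).
    Such points are found by degeneration ([no_singular_curve]): a curve of
    degree d singular at the nodes of about d/2 + 2 lines in general position
    contains all the lines, because it meets each of them with multiplicity
    more than d; what remains is a curve of degree about d/2, to which the
    same construction applies.  The numbers of nodes add up to
    d^2/8 + d^2/32 + ... = d^2/6, with an error linear in d.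

    The maximum over monomials is d^2/4 up to a linear error, so its ratio to
    3/2 times d^2/6 tends to 1 ([ratio_cvg]). *)

Module WaringRank.
Import GRing.Theory mpoly.
Set Implicit Arguments.
Unset Strict Implicit.
Unset Printing Implicit Defensive.
Local Open Scope ring_scope.

(** * Plane curves singular at the nodes of a line arrangement *)

(** Total degree less than D in the two variables.  The subtraction is
    truncated, so coefficients of index at least D vanish and D = 0 leaves only
    the zero polynomial. *)
Definition tdeg_lt (R : nzRingType) (D : nat) (f : {poly {poly R}}) : Prop :=
  forall i, (size (f`_i)%R <= D - i)%N.

Lemma tdeg_lt0 (R : nzRingType) (f : {poly {poly R}}) : tdeg_lt 0 f -> f = 0.
Proof.
move=> h; apply/polyP=> i; rewrite coef0; apply/eqP.
by rewrite -size_poly_eq0 -leqn0; apply: leq_trans (h i) _; rewrite sub0n.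
Qed.

Lemma size_mul_le_degree1 (R : nzRingType) (c p : {poly R}) :
  (size c <= 2)%N -> (size (c * p)%R <= (size p).+1)%N.
Proof.
move=> sc; apply: leq_trans (size_polyMleq _ _) _.
by rewrite -ltnS; apply: leq_trans (leqSpred _) _; move: sc; lia.
Qed.

Lemma size_exp_mul_le (R : nzRingType) (c p : {poly R}) i :
  (size c <= 2)%N -> (size (c ^+ i * p)%R <= i + size p)%N.
Proof.
move=> sc; elim: i => [|i IHi]; first by rewrite expr0 mul1r.
by rewrite exprS -mulrA; apply: leq_trans (size_mul_le_degree1 _ sc) _.
Qed.

(** The coefficients of the quotient satisfy g_i = f_(i+1) + c g_(i+1); going
    down from the leading one, each step raises the degree by at most one
    because deg c <= 1. *)
Lemma tdeg_lt_divXsubC (R : idomainType) D (c : {poly R}) (g : {poly {poly R}}) :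
  (size c <= 2)%N -> tdeg_lt D.+1 (g * ('X - c%:P)) -> tdeg_lt D g.
Proof.
move=> sc hf i.
have [n le_n] : exists n, (size g <= i + n)%N by exists (size g); rewrite leq_addl.
elim: n i le_n => [|n IHn] i le_n.
  by rewrite nth_default ?size_poly0 //; rewrite addn0 in le_n.
have eg : g`_i = (g * ('X - c%:P))`_i.+1 + c * g`_i.+1.
  by rewrite mulrBr coefB coefMX coefMC /= mulrC subrK.
have := IHn i.+1; rewrite addSnnS => /(_ le_n) hS.
rewrite eg; apply: leq_trans (size_polyD _ _) _; rewrite geq_max.
apply/andP; split; first exact: hf.
have [->|nz] := eqVneq g`_i.+1 0; first by rewrite mulr0 size_poly0.
have : (0 < size (g`_i.+1)%R)%N by rewrite size_poly_gt0.
move=> pos; apply: leq_trans (size_mul_le_degree1 _ sc) _.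
rewrite (leq_trans (n := (D - i.+1).+1)) // subnSK // -subn_gt0.
by apply: leq_trans pos _; apply: leq_trans hS _; rewrite leq_sub2l.
Qed.

Lemma tdeg_lt_horner (R : idomainType) D (c : {poly R}) (f : {poly {poly R}}) :
  (size c <= 2)%N -> tdeg_lt D f -> (size f.[c] <= D)%N.
Proof.
move=> sc hf; rewrite horner_coef; apply: leq_trans (size_sum _ _ _) _.
apply/bigmax_leqP => i _.
have [->|nz] := eqVneq f`_i 0; first by rewrite mul0r size_poly0.
have : (0 < size (f`_i)%R)%N by rewrite size_poly_gt0.
move=> pos; rewrite mulrC; apply: leq_trans (size_exp_mul_le _ _ sc) _.
have di : (i < D)%N by rewrite -subn_gt0; exact: leq_trans pos (hf i).
by rewrite -leq_subRL ?hf // ltnW.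
Qed.

(** The roots are lines X = c(Y).  Differences of polynomials in Y are not
    units, so the lines are divided out one at a time: a root of a product in
    an integral domain is a root of a factor. *)
Lemma factor_roots (R : idomainType) D (cs : seq {poly R}) (f : {poly {poly R}}) :
  uniq cs -> all (fun c : {poly R} => (size c <= 2)%N) cs -> all (root f) cs ->
  tdeg_lt D f ->
  exists2 g, f = g * \prod_(c <- cs) ('X - c%:P) & tdeg_lt (D - size cs) g.
Proof.
elim: cs D f => [|c cs IHcs] D f /=.
  by move=> _ _ _ hf; exists f; rewrite ?big_nil ?mulr1 ?subn0.
move=> /andP [nc ucs] /andP [sc scs] /andP [/factor_theorem [g eg] rcs] hf.
case: D hf => [|D] hf.
  by exists 0; rewrite ?mul0r; [apply: tdeg_lt0 | move=> i; rewrite coef0 size_poly0].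
have hg : tdeg_lt D g by apply: (tdeg_lt_divXsubC sc); rewrite -eg.
have rg : all (root g) cs.
  apply/allP=> c' c'in; have := allP rcs c' c'in.
  rewrite eg rootM root_XsubC => /orP [//|/eqP ec].
  by rewrite -ec c'in in nc.
have [h eh th] := IHcs _ _ ucs scs rg hg.
by exists h; rewrite ?subSS // big_cons eg eh mulrAC -mulrA.
Qed.

(** All elements of rs are roots of multiplicity at least two. *)
Lemma double_roots_eq0 (R : idomainType) (h : {poly R}) (rs : seq R) :
  uniq rs -> all (root h) rs -> all (root h^`()) rs ->
  (size h <= 2 * size rs)%N -> h = 0.
Proof.
elim: rs h => [|r rs IHrs] h /=.
  by rewrite muln0 leqn0 size_poly_eq0 => _ _ _ /eqP.
move=> /andP [nr urs] /andP [/factor_theorem [g eg] rh] /andP [rh' rhs'] sh.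
have /factor_theorem [g' eg'] : root g r.
  move: rh'; rewrite eg derivM derivXsubC mulr1 rootE !hornerE subrr mulr0 add0r.
  by rewrite -rootE.
have eh : h = g' * ('X - r%:P) ^+ 2 by rewrite eg eg' expr2 mulrA.
have [g0|gnz] := eqVneq g' 0; first by rewrite eh g0 mul0r.
suff g0 : g' = 0 by rewrite eh g0 mul0r.
have nx x : x \in rs -> x - r != 0.
  by move=> xin; rewrite subr_eq0; apply: contraNneq nr => <-.
have rg : all (root g') rs.
  apply/allP=> x xin; have := allP rh x xin.
  by rewrite eh !rootE hornerM horner_exp hornerXsubC mulf_eq0 sqrf_eq0
             (negPf (nx x xin)) orbF.
apply: IHrs => //.
- apply/allP=> x xin; have /eqP gx := allP rg x xin; have := allP rhs' x xin.
  rewrite eh !rootE derivM hornerD hornerM [X in _ + X]hornerM.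
  rewrite gx mul0r addr0 horner_exp hornerXsubC.
  by rewrite mulf_eq0 sqrf_eq0 (negPf (nx x xin)) orbF.
- move: sh; rewrite eh size_Mmonic ?monic_exp ?monicXsubC // size_exp_XsubC.
  have : (0 < size g')%N by rewrite size_poly_gt0.
  lia.
Qed.

Section PlaneCurves.
Variable k : fieldType.
Implicit Types (f g h : {poly {poly k}}) (c : {poly k}) (q : k * k).

Definition evalxy f q : k := f.[(q.1)%:P].[q.2].
Definition deriv_y f : {poly {poly k}} := map_poly (@deriv k) f.

Definition singular_at f q : Prop :=
  [/\ evalxy f q = 0, evalxy f^`() q = 0 & evalxy (deriv_y f) q = 0].

Lemma evalxyM f g q : evalxy (f * g) q = evalxy f q * evalxy g q.
Proof. by rewrite /evalxy !hornerM. Qed.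

Lemma evalxyD f g q : evalxy (f + g) q = evalxy f q + evalxy g q.
Proof. by rewrite /evalxy !hornerD. Qed.

Lemma deriv_yM f g : deriv_y (f * g) = deriv_y f * g + f * deriv_y g.
Proof.
apply/polyP=> i; rewrite coefD coef_map /= !coefM raddf_sum -big_split /=.
by apply: eq_bigr => j _; rewrite derivM !coef_map.
Qed.

Lemma singular_at_factor g h q :
  evalxy h q != 0 -> singular_at (g * h) q -> singular_at g q.
Proof.
move=> hq []; rewrite derivM deriv_yM !evalxyD !evalxyM.
move=> /eqP; rewrite mulf_eq0 (negPf hq) orbF => /eqP g0.
rewrite g0 !mul0r !addr0 => /eqP; rewrite mulf_eq0 (negPf hq) orbF => /eqP gx.
by move=> /eqP; rewrite mulf_eq0 (negPf hq) orbF => /eqP gy.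
Qed.

(** With [deriv_horner], this makes a singular point of f on the line X = c(Y)
    a double root of the restriction of f to that line. *)
Lemma horner_line f c y : f.[c].[y] = evalxy f (c.[y], y).
Proof.
rewrite /evalxy /=; elim/poly_ind: f => [|f a IHf]; first by rewrite !horner0.
by rewrite !hornerMXaddC !hornerD !hornerM IHf hornerC.
Qed.

Lemma deriv_horner f c : (f.[c])^`() = f^`().[c] * c^`() + (deriv_y f).[c].
Proof.
elim/poly_ind: f => [|f a IHf].
  by rewrite /deriv_y map_poly0 deriv0 !horner0 mul0r deriv0 add0r.
have -> : deriv_y (f * 'X + a%:P) = deriv_y f * 'X + (a^`())%:P.
  apply/polyP=> -[|i]; rewrite coef_map /= !coefD !coefC !coefMX /= ?coef_map //=.
    by rewrite !add0r.
  by rewrite !addr0.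
rewrite !hornerMXaddC derivD derivM IHf derivD derivC addr0 derivM derivX mulr1.
rewrite hornerD hornerM hornerX; ring.
Qed.

(** The line x = t y - t^2, tangent to the conic y^2 = 4 x.  The tangents of
    parameters t and u meet in (t u, t + u), and no three are concurrent. *)
Definition conic_tangent (t : k) : {poly k} := t *: 'X - (t ^+ 2)%:P.

Fixpoint nodes (T : seq k) : seq (k * k) :=
  if T is t :: T' then [seq (t * u, t + u) | u <- T'] ++ nodes T' else [::].

Lemma size_nodes T : size (nodes T) = 'C(size T, 2).
Proof. by elim: T => //= t T IHT; rewrite size_cat size_map IHT binS bin1 addnC. Qed.

Lemma mem_nodes T t u :
  t \in T -> u \in T -> t != u -> (t * u, t + u) \in nodes T.
Proof.
elim: T => //= a T IHT; rewrite !inE mem_cat => /orP [/eqP ->|tT] /orP [/eqP ->|uT].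
- by rewrite eqxx.
- by move=> _; rewrite (map_f (fun u => (a * u, a + u))).
- by move=> _; rewrite mulrC addrC (map_f (fun u => (a * u, a + u))).
- by move=> ne; rewrite IHT ?orbT.
Qed.

Lemma conic_tangent_horner t u : (conic_tangent t).[t + u] = t * u.
Proof. rewrite /conic_tangent !hornerE; ring. Qed.

Lemma conic_tangent_inj : injective conic_tangent.
Proof.
move=> t u /polyP /(_ 1%N).
by rewrite !coefB !coefZ !coefX !coefC /= !mulr1 !subr0.
Qed.

Lemma size_conic_tangent t : (size (conic_tangent t) <= 2)%N.
Proof.
rewrite /conic_tangent; apply: leq_trans (size_polyD _ _) _.
rewrite geq_max size_polyN (leq_trans (size_polyC_leq1 _)) // andbT.
by apply: leq_trans (size_scale_leq _ _) _; rewrite size_polyX.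
Qed.

(** The restriction of f to the tangent of parameter t has degree less than D
    and double roots at the size T - 1 nodes on that tangent. *)
Lemma tangent_component D f T t : tdeg_lt D f -> uniq T -> t \in T ->
  (D <= 2 * (size T).-1)%N -> {in nodes T, forall q, singular_at f q} ->
  f.[conic_tangent t] = 0.
Proof.
move=> df uT tT sT sing.
have node u : u \in rem t T -> singular_at f (t * u, t + u).
  rewrite mem_rem_uniq // => /andP [/= ne uinT]; apply: sing.
  by rewrite mem_nodes // eq_sym.
apply: (@double_roots_eq0 _ _ [seq t + u | u <- rem t T]).
- by rewrite map_inj_uniq ?rem_uniq //; apply: addrI.
- apply/allP=> _ /mapP [u /node [f0 _ _] ->].
  by rewrite rootE horner_line conic_tangent_horner f0.
- apply/allP=> _ /mapP [u /node [_ fx fy] ->].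
  rewrite rootE deriv_horner hornerD hornerM !horner_line conic_tangent_horner.
  by rewrite fx fy mul0r addr0.
- rewrite size_map size_rem //; apply: leq_trans sT.
  exact: tdeg_lt_horner (size_conic_tangent t) df.
Qed.

(** In characteristic zero the images of 0, 1, 2, ... are distinct, and fewer
    than size b of them are roots of b. *)
Lemma uniq_nonroots (k_char0 : [pchar k] =i pred0) (b : {poly k}) n :
  b != 0 -> exists T : seq k, [/\ size T = n, uniq T & all (fun t => ~~ root b t) T].
Proof.
move=> b0; pose s := [seq i%:R : k | i <- iota 0 (n + size b)].
have us : uniq s.
  rewrite map_inj_in_uniq ?iota_uniq // => i j _ _ /eqP eij; apply/eqP.
  wlog lij : i j eij / (i <= j)%N.
    move=> W; case/orP: (leq_total i j) => le; [|rewrite eq_sym];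
      by apply: W; rewrite // eq_sym.
  move: eij; rewrite -subr_eq0 -opprB oppr_eq0 -natrB //.
  move/pcharf0P: k_char0 => ->; rewrite subn_eq0 => lji.
  by rewrite eqn_leq lij lji.
have sr : (size [seq x <- s | root b x] < size b)%N.
  by apply: max_poly_roots; rewrite ?filter_uniq ?filter_all.
exists (take n [seq x <- s | ~~ root b x]); split.
- rewrite size_takel // size_filter -(leq_add2l (count (root b) s)).
  rewrite (count_predC (root b)) size_map size_iota addnC leq_add2l -size_filter.
  exact: ltnW.
- by rewrite take_uniq // filter_uniq.
- by apply/allP=> x /mem_take; rewrite mem_filter => /andP [].
Qed.

(** With u the half of D rounded up, a curve of degree less than D that is
    singular at the nodes of u + 1 tangents contains all these tangents, and the
    residual curve has degree less than D - (u + 1).  Induction provides points Q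
    for the residual curves.  They are chosen before the tangents, which then
    avoid Q, so that dividing by the tangents preserves the singularities at
    Q.  The number of points satisfies s(D) = u (u + 1) / 2 + s(D - u - 1),
    whence s(D) is at most (D + 1) (D + 2) / 6. *)
Lemma no_singular_curve (k_char0 : [pchar k] =i pred0) (D : nat) :
  exists2 Q : seq (k * k), (6 * size Q <= D.+1 * D.+2)%N &
    forall f, tdeg_lt D f -> {in Q, forall q, singular_at f q} -> f = 0.
Proof.
elim/ltn_ind: D => -[_|D IHD]; first by exists [::] => // f /tdeg_lt0.
set u := uphalf D.+1.
have [|Q sQ hQ] := IHD (D.+1 - u.+1)%N; first by rewrite /u; lia.
(* The tangent of parameter t passes through q iff q.1 - t q.2 + t^2 = 0. *)
pose b := \prod_(q <- Q) ((q.1)%:P - (q.2) *: 'X + 'X^2) : {poly k}.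
have b0 : b != 0.
  rewrite /b prodf_seq_neq0; apply/allP=> q _ /=; apply/eqP => /polyP /(_ 2).
  rewrite !coefD coefN coefZ coefC coefX coefXn /= mulr0 subr0 add0r coef0 => /eqP.
  by rewrite oner_eq0.
have [T [sT uT rT]] := uniq_nonroots k_char0 u.+1 b0.
exists (nodes T ++ Q).
  rewrite size_cat size_nodes sT.
  have := mul_bin_diag u.+1 1; rewrite bin1 /=.
  have : (D.+1 <= u.*2 <= D.+2)%N by rewrite /u; lia.
  move: sQ {hQ sT uT rT T}; move: (size Q) u 'C(_, _) => s [|v] C; first by lia.
  (* When the residual bound is 0, possibly by truncation, 6 s <= 2 and s = 0. *)
  case: (posnP (D.+1 - v.+2)%N) => [->|]; first by nia.
  by move=> pos; nia.
move=> f df sing.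
have [|||g ef dg] := @factor_roots _ D.+1 [seq conic_tangent t | t <- T] f _ _ _ df.
- by rewrite map_inj_uniq //; apply: conic_tangent_inj.
- by apply/allP=> _ /mapP [t _ ->]; apply: size_conic_tangent.
- apply/allP=> _ /mapP [t tT ->]; apply/eqP; apply: tangent_component df uT tT _ _.
    by rewrite sT /= /u; lia.
  by move=> q qin; apply: sing; rewrite mem_cat qin.
move: dg; rewrite size_map sT => dg.
rewrite ef (hQ g dg) ?mul0r // => q qQ.
apply: (singular_at_factor
  (h := \prod_(c <- [seq conic_tangent t | t <- T]) ('X - c%:P))); last first.
  by rewrite -ef; apply: sing; rewrite mem_cat qQ orbT.
rewrite /evalxy !horner_prod big_map prodf_seq_neq0; apply/allP=> t tT /=.
have := allP rT t tT; rewrite /b /root horner_prod prodf_seq_neq0 => /allP /(_ q qQ) /=.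
apply: contra => /eqP h; apply/eqP; rewrite -[RHS]h /conic_tangent !hornerE /=; ring.
Qed.

End PlaneCurves.

(** * Sums of powers and moments of points *)

Section Moments.
Variable k : fieldType.
Implicit Types (p : 'I_3 -> k) (m : 'X_{1..3}) (F L : {mpoly k[3]}).

Definition linear_form p : {mpoly k[3]} := \sum_i p i *: 'X_i.

Lemma linear_formP L : L \is 1.-homog -> L = linear_form (fun i => L@_U_(i)).
Proof.
move=> hL; apply/mpolyP=> m; rewrite /linear_form raddf_sum /=.
have [/mdeg1P [i /eqP ->]|nm] := boolP (mdeg m == 1%N).
  rewrite (bigD1 i) //= mcoeffZ mcoeffX eqxx mulr1 big1 ?addr0 // => j ne.
  by rewrite mcoeffZ mcoeffXU (negPf ne) mulr0.
rewrite (dhomog_nemf_coeff hL nm) big1 // => i _.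
rewrite mcoeffZ mcoeffX; case: eqP => [e|]; last by rewrite mulr0.
by rewrite -e mdeg1 in nm.
Qed.

Lemma linear_form_homog p : linear_form p \is 1.-homog.
Proof. by apply: rpred_sum => i _; rewrite dhomogZ // dhomogX; apply/eqP/mdeg1. Qed.

Lemma mcoeffMU n (R : nzRingType) (F : {mpoly R[n]}) i (m : 'X_{1..n}) :
  (F * 'X_i)@_m = if m i == 0%N then 0 else F@_(m - U_(i)).
Proof.
case: eqP => [mi|/eqP mi]; last first.
  rewrite -(mcoeffMX F U_(i) (m - U_(i))) addmC submK //.
  by rewrite lep1mP.
apply/eqP; rewrite mcoeff_eq0 (perm_mem (msuppMX _ _)); apply/mapP => -[m' _ e].
by move: mi; rewrite e mnmDE mnm1E eqxx.
Qed.

(** The multinomial coefficient d! / (m_0! m_1! m_2!), for m of degree d, by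
    its Pascal recursion: this is how the coefficients of a d-th power arise, and
    it makes positivity immediate. *)
Fixpoint multinomial (d : nat) (m : 'X_{1..3}) : nat :=
  if d is d'.+1 then (\sum_(i | m i != 0%N) multinomial d' (m - U_(i))%MM)%N
  else 1.

Lemma mdeg_subU n (m : 'X_{1..n}) i : m i != 0%N -> mdeg (m - U_(i)) = (mdeg m).-1.
Proof.
rewrite -lep1mP => /submK e.
by rewrite -{2}e mdegD mdeg1 addn1.
Qed.

Lemma mdeg_neq0_ex n (m : 'X_{1..n}) : mdeg m != 0%N -> exists i, m i != 0%N.
Proof.
rewrite mdeg_eq0; move=> nm; apply/existsP; apply: contraNT nm.
rewrite negb_exists => /forallP h; apply/eqP/mnmP=> i; rewrite mnm0E.
by apply/eqP; have := h i; rewrite negbK.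
Qed.

Lemma multinomial_gt0 d m : mdeg m = d -> (0 < multinomial d m)%N.
Proof.
elim: d m => //= d IHd m dm.
have [|i mi] := @mdeg_neq0_ex _ m; first by rewrite dm.
by rewrite (bigD1 i) //= addn_gt0 IHd // mdeg_subU // dm.
Qed.

Lemma mcoeff_power_linear_form p d m : mdeg m = d ->
  (linear_form p ^+ d)@_m = (multinomial d m)%:R * 'X_[m].@[p].
Proof.
elim: d m => [|d IHd] m dm.
  move/eqP: (dm); rewrite mdeg_eq0 => /eqP ->.
  by rewrite expr0 mcoeff1 eqxx mpolyX0 meval1 mulr1.
rewrite exprSr /linear_form mulr_sumr raddf_sum /= natr_sum mulr_suml.
rewrite [RHS]big_mkcond /=; apply: eq_bigr => i _.
rewrite -scalerAr mcoeffZ mcoeffMU; case: eqP => [|/eqP mi] /=; first by rewrite mulr0.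
rewrite IHd ?mdeg_subU ?dm // mulrCA; congr (_ * _).
by rewrite -{2}[m](@submK _ U_(i)) ?lep1mP // mpolyXD mevalM mevalXU mulrC.
Qed.

(** The dictionary between sums of powers of linear forms and moments of
    points: p i is the coefficient vector of the i-th linear form. *)
Lemma sum_of_powersP d F s : F \is d.-homog ->
  sum_of_powers d F s <->
  exists p : 'I_s -> 'I_3 -> k, forall m, mdeg m = d ->
    F@_m = (multinomial d m)%:R * \sum_i 'X_[m].@[p i].
Proof.
move=> hF; split=> [[L [hL ->]]|[p hp]].
  exists (fun i j => (L i)@_U_(j)) => m dm.
  rewrite raddf_sum mulr_sumr /=; apply: eq_bigr => i _.
  by rewrite {1}(linear_formP (hL i)) mcoeff_power_linear_form.
exists (fun i => linear_form (p i)); split=> [i|]; first exact: linear_form_homog.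
have hS : \sum_(i < s) linear_form (p i) ^+ d \is d.-homog.
  apply: rpred_sum => i _; 
  by have := dhomogMn d (linear_form_homog (p i)); rewrite mul1n.
apply/mpolyP => m; have [dm|nm] := eqVneq (mdeg m) d; last first.
  by rewrite (dhomog_nemf_coeff hF nm) (dhomog_nemf_coeff hS nm).
rewrite hp // raddf_sum mulr_sumr /=; apply: eq_bigr => i _.
by rewrite mcoeff_power_linear_form.
Qed.

Lemma rk_leq d F s : sum_of_powers d F s -> (rk d F <= s)%N.
Proof.
move=> h; rewrite /rk; case: pselect => // ex.
by case: ex_minnP => n _; apply; apply/asboolP.
Qed.

(** For a sum of powers, rk is a true minimum and not its default value. *)
Lemma rkP d F s : sum_of_powers d F s -> sum_of_powers d F (rk d F).
Proof.
move=> h; rewrite /rk; case: pselect => [ex|[]]; last by exists s; apply/asboolP.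
by case: ex_minnP => n /asboolP.
Qed.

Lemma linear_system_nontrivial (I J : finType) (A : I -> J -> k) :
  (#|J| < #|I|)%N ->
  exists2 f : I -> k, (exists i, f i != 0) & forall j, \sum_i f i * A i j = 0.
Proof.
move=> lt; pose B := \matrix_(i < #|I|, j < #|J|) A (enum_val i) (enum_val j).
have : kermx B != 0.
  rewrite -mxrank_eq0 mxrank_ker -lt0n subn_gt0.
  exact: leq_ltn_trans (rank_leq_col B) lt.
case/rowV0Pn=> v /sub_kermxP vB v0.
exists (fun i => v 0 (enum_rank i)).
  move/rV0Pn: v0 => [i vi]; exists (enum_val i).
  by rewrite enum_valK.
move=> j; have := congr1 (fun M : 'rV_ _ => M 0 (enum_rank j)) vB.
rewrite !mxE => e; rewrite -[RHS]e (reindex (@enum_val I I)) /=; last first.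
  by exists enum_rank => i _; rewrite ?enum_rankK ?enum_valK.
by apply: eq_bigr => i _; rewrite enum_valK mxE enum_rankK.
Qed.

End Moments.

(** * Ranks of monomials *)

(** The variables are listed in an arbitrary order i0, i1, i2, so that the
    exponents of a monomial can be assumed sorted. *)
Section Coordinates.
Variables (i0 i1 i2 : 'I_3).
Hypothesis u3 : uniq [:: i0; i1; i2].

Lemma I3P (i : 'I_3) : [|| i == i0, i == i1 | i == i2].
Proof.
have [||_ e] := @uniq_min_size _ [:: i0; i1; i2] (enum 'I_3) u3.
- by move=> j _; rewrite mem_enum.
- by rewrite size_enum_ord.
- by have := e i; rewrite mem_enum !inE.
Qed.

Lemma big_I3 (R : Type) (idx : R) (op : Monoid.com_law idx) (F : 'I_3 -> R) :
  \big[op/idx]_i F i = op (F i0) (op (F i1) (F i2)).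
Proof.
have e : perm_eq (index_enum 'I_3) [:: i0; i1; i2].
  apply: uniq_perm => //; first exact: index_enum_uniq.
  by move=> i; rewrite mem_index_enum !inE I3P.
by rewrite (perm_big _ e) /= !big_cons big_nil Monoid.mulm1.
Qed.

Lemma mdeg_I3 (m : 'X_{1..3}) : mdeg m = (m i0 + (m i1 + m i2))%N.
Proof. by rewrite mdegE big_I3. Qed.

Lemma meval_I3 (k : fieldType) (p : 'I_3 -> k) (m : 'X_{1..3}) :
  'X_[m].@[p] = p i0 ^+ m i0 * (p i1 ^+ m i1 * p i2 ^+ m i2).
Proof. by rewrite mevalX big_I3. Qed.

Definition triple (T : Type) (a b c : T) (i : 'I_3) : T :=
  if i == i0 then a else if i == i1 then b else c.

Lemma triple0 T (a b c : T) : triple a b c i0 = a.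
Proof. by rewrite /triple eqxx. Qed.

Lemma triple1 T (a b c : T) : triple a b c i1 = b.
Proof.
case/and3P: u3; rewrite !inE negb_or eq_sym /triple => /andP [/negPf -> _] _ _.
by rewrite eqxx.
Qed.

Lemma triple2 T (a b c : T) : triple a b c i2 = c.
Proof.
case/and3P: u3; rewrite !inE negb_or /triple ![i2 == _]eq_sym.
by move=> /andP [_ /negPf ->] /negPf ->.
Qed.

Lemma eq_I3 (m m' : 'X_{1..3}) :
  m i0 = m' i0 -> m i1 = m' i1 -> m i2 = m' i2 -> m = m'.
Proof. by move=> e0 e1 e2; apply/mnmP=> i; case/or3P: (I3P i) => /eqP ->. Qed.

Definition mnm3 (a b c : nat) : 'X_{1..3} := [multinom triple a b c i | i < 3].

Lemma mnm3E a b c :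
  (mnm3 a b c i0 = a) * (mnm3 a b c i1 = b) * (mnm3 a b c i2 = c).
Proof. by rewrite !mnmE triple0 triple1 triple2. Qed.

(** Apolarity in terms of moments.  With b = m i1 and c = m i2, fewer than
    (b + 1) (c + 1) points are annihilated, where x <> 0, by a nonzero combination
    f of the functions (y/x)^j (z/x)^l with j <= b and l <= c.  If f has degree t,
    then x^(t+1) f, which is polynomial and divisible by x, vanishes at all the
    points; so does its product with y^(b-j0) z^(c-l0), where y^j0 z^l0 is a
    leading monomial of f.  Summing over the points leaves only the moment at m,
    with the nonzero coefficient of y^j0 z^l0. *)
Lemma rank_monomial_ge (k : fieldType) (k_char0 : [pchar k] =i pred0)
    (m : 'X_{1..3}) s :
  m i0 = 1%N -> sum_of_powers (mdeg m) ('X_[m] : {mpoly k[3]}) s ->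
  ((m i1).+1 * (m i2).+1 <= s)%N.
Proof.
move=> m0 /sum_of_powersP; rewrite dhomogX eqxx => /(_ isT) [p hp].
set b := m i1; set c := m i2.
have dm : mdeg m = (1 + (b + c))%N by rewrite mdeg_I3 m0.
rewrite leqNgt; apply/negP => lt.
pose y i := p i i1 / p i i0; pose z i := p i i2 / p i i0.
pose A (jl : 'I_b.+1 * 'I_c.+1) i : k :=
  if p i i0 == 0 then 0 else y i ^+ jl.1 * z i ^+ jl.2.
have [|f [jl fjl] fA] := @linear_system_nontrivial _ _ _ A.
  by rewrite card_prod !card_ord.
(* A leading monomial y^j0 z^l0 of the vanishing polynomial, of degree t. *)
case: (@arg_maxnP _ jl (fun jl => f jl != 0) (fun jl => jl.1 + jl.2)%N fjl).
move=> -[j0 l0] /= f0 hmax.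
set t := (j0 + l0)%N in hmax.
(* The exponents occurring in x^(t+1) y^(b-j0) z^(c-l0) f. *)
pose M (jl : 'I_b.+1 * 'I_c.+1) :=
  mnm3 (1 + t - (jl.1 + jl.2)) (jl.1 + (b - j0)) (jl.2 + (c - l0)).
have jb : (j0 <= b)%N by rewrite -ltnS.
have lc : (l0 <= c)%N by rewrite -ltnS.
have S0 : \sum_jl f jl * \sum_i 'X_[M jl].@[p i] = 0.
  under eq_bigr do rewrite mulr_sumr; rewrite exchange_big big1 // => i _ /=.
  have := fA i; rewrite /A; case: eqP => [x0 _|/eqP x0 e].
    rewrite big1 // => -[j l] _.
    have [->|fn] := eqVneq (f (j, l)) 0; first by rewrite mul0r.
    have /= le := hmax _ fn.
    by rewrite meval_I3 !mnm3E x0 expr0n subn_eq0 ltnNge le mul0r mulr0.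
  transitivity (p i i0 ^+ t.+1 * p i i1 ^+ (b - j0) * p i i2 ^+ (c - l0) *
                \sum_jl f jl * (y i ^+ jl.1 * z i ^+ jl.2)); last by rewrite e mulr0.
  rewrite mulr_sumr; apply: eq_bigr => -[j l] _ /=.
  have [->|fn] := eqVneq (f (j, l)) 0; first by rewrite !mul0r mulr0.
  have /= le := hmax _ fn.
  rewrite meval_I3 !mnm3E /= add1n !exprD /y /z !expr_div_n.
  have -> : p i i0 ^+ t.+1 = p i i0 ^+ (t.+1 - (j + l)) * p i i0 ^+ j * p i i0 ^+ l.
    by rewrite -mulrA -!exprD subnK // ltnW.
  have xj : p i i0 ^+ j != 0 by rewrite expf_neq0.
  have xl : p i i0 ^+ l != 0 by rewrite expf_neq0.
  field; exact/andP.
have hM jl' : f jl' != 0 -> mdeg (M jl') = mdeg m.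
  move=> fn; have /= le := hmax _ fn.
  move: le; rewrite dm mdeg_I3 !mnm3E /t; move: jb lc.
  by move: jl' fn => [[j /= _] [l /= _]] _; lia.
have := hp m erefl; rewrite mcoeffX eqxx /=.
move: S0; rewrite (bigD1 (j0, l0)) //= [X in _ + X = _]big1 ?addr0; last first.
  move=> jl' ne; have [->|fn] := eqVneq (f jl') 0; first by rewrite mul0r.
  have := hp _ (hM _ fn); rewrite mcoeffX; case: eqP => [e|_ /esym/eqP].
    case/eqP: ne; case: jl' fn e => j l fn e.
    have e1 : j = j0 :> nat.
      by have := congr1 (fun m' : 'X_{1..3} => m' i1) e; rewrite !mnm3E -/b /=; lia.
    have e2 : l = l0 :> nat.
      by have := congr1 (fun m' : 'X_{1..3} => m' i2) e; rewrite !mnm3E -/c /=; lia.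
    by congr pair; apply: val_inj.
  rewrite mulf_eq0 => /orP [|/eqP ->]; last by rewrite mulr0.
  move/pcharf0P: k_char0 => ->; rewrite -leqn0 leqNgt.
  by rewrite multinomial_gt0 // hM.
have -> : M (j0, l0) = m.
  by apply: eq_I3; rewrite !mnm3E /= ?m0 -/b -/c /t; lia.
move/eqP; rewrite mulf_eq0 (negPf f0) /= => /eqP ->.
by rewrite mulr0 => /eqP; rewrite oner_eq0.
Qed.

End Coordinates.

Section MonomialRank.
Variable k : closedFieldType.
Hypothesis k_char0 : [pchar k] =i pred0.

Lemma natr_neq0 n : (0 < n)%N -> n%:R != 0 :> k.
Proof. by rewrite lt0n; move/pcharf0P: k_char0 => ->. Qed.

Lemma closed_root_exists d (w : k) : (0 < d)%N -> exists x, x ^+ d = w.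
Proof.
case: d => // d _.
have [x ex] := @GRing.solve_monicpoly k d.+1 (fun i => if i == 0%N then w else 0) isT.
exists x; rewrite ex {ex}.
by rewrite big_ord_recl /= expr0 mulr1 big1 ?addr0 // => i _; rewrite mul0r.
Qed.

Lemma prim_root_exists n : (0 < n)%N -> exists z : k, n.-primitive_root z.
Proof.
pose p : {poly k} := 'X^n - 1; have [r Dp] := closed_field_poly_normal p.
move=> n_gt0; rewrite (monicP _) ?monicXnsubC // scale1r in Dp.
have rn1: all n.-unity_root r by apply/allP=> z; rewrite -root_prod_XsubC -Dp.
have sz_r: (n < (size r).+1)%N by rewrite -(size_prod_XsubC r id) -Dp size_XnsubC.
have [|z] := hasP (has_prim_root n_gt0 rn1 _ sz_r); last by exists z.
by rewrite -separable_prod_XsubC -Dp separable_Xn_sub_1 // natr_neq0.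
Qed.

(** Orthogonality of characters: the ratio is a root of X^n - 1, so it is 1 or
    a root of 1 + X + ... + X^(n-1). *)
Lemma sum_prim_root_powers n (z : k) i j : n.-primitive_root z ->
  \sum_(a < n) (z ^+ i / z ^+ j) ^+ a = if i == j %[mod n] then n%:R else 0.
Proof.
move=> pz; have zj : z ^+ j != 0.
  rewrite expf_neq0 // (prim_root_eq0 pz).
  by have := prim_order_gt0 pz; case: (n).
case: ifP => [e|ne].
  have -> : z ^+ i = z ^+ j by apply/eqP; rewrite (eq_prim_root_expr pz).
  rewrite divff // -[n in RHS]card_ord -sumr_const.
  by apply: eq_bigr => a _; rewrite expr1n.
have y1 : z ^+ i / z ^+ j - 1 != 0.
  rewrite subr_eq0; apply: contraFneq ne => e.
  by rewrite -(eq_prim_root_expr pz) -[z ^+ i](divfK zj) e mul1r.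
apply: (mulfI y1); rewrite -subrX1 mulr0 expr_div_n ![(z ^+ _) ^+ n]exprAC.
by rewrite (prim_expr_order pz) !expr1n divr1 subrr.
Qed.

(** Over an algebraically closed field a weight is absorbed into its point,
    multiplied by a d-th root of the weight. *)
Lemma sum_of_weighted_powers (I : finType) d (F : {mpoly k[3]}) (w : I -> k)
    (p : I -> 'I_3 -> k) :
  (0 < d)%N -> F \is d.-homog ->
  (forall m, mdeg m = d ->
     F@_m = (multinomial d m)%:R * \sum_i w i * 'X_[m].@[p i]) ->
  sum_of_powers d F #|I|.
Proof.
move=> d0 hF hp; apply/(sum_of_powersP _ hF).
have hc i : exists x, x ^+ d == w i.
  by have [x <-] := closed_root_exists (w i) d0; exists x.
pose c i := xchoose (hc i); have cd i : c i ^+ d = w i by apply/eqP/(xchooseP (hc i)).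
exists (fun e j => c (enum_val e) * p (enum_val e) j) => m dm.
rewrite hp //; congr (_ * _); rewrite (reindex (@enum_val I I)) /=; last first.
  by exists enum_rank => i _; rewrite ?enum_rankK ?enum_valK.
apply: eq_bigr => e _; rewrite !mevalX -cd.
rewrite -dm mdegE -prodrXr -big_split /=.
by apply: eq_bigr => j _; rewrite exprMn.
Qed.

(** The points (alpha, x^a, y^b), for x and y primitive roots of unity of
    orders B and C, are weighted by characters.  Their moment at m' vanishes unless
    m' is congruent to m modulo B and C in the last two exponents; taking alpha = 0
    moreover discards all monomials in which the first variable occurs. *)
Lemma monomial_sum_of_powers (i0 i1 i2 : 'I_3) (u3 : uniq [:: i0; i1; i2])
    (m : 'X_{1..3}) (alpha : k) B C :
  (0 < mdeg m)%N -> (0 < B)%N -> (0 < C)%N -> alpha ^+ m i0 = 1 ->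
  (forall m', mdeg m' = mdeg m -> alpha ^+ m' i0 != 0 ->
     m' i1 = m i1 %[mod B] -> m' i2 = m i2 %[mod C] -> m' = m) ->
  sum_of_powers (mdeg m) ('X_[m] : {mpoly k[3]}) (B * C).
Proof.
move=> dm B0 C0 am uniq_m.
have [x px] := prim_root_exists B0; have [y py] := prim_root_exists C0.
set K := (multinomial (mdeg m) m)%:R * (B%:R * C%:R) : k.
have K0 : K != 0 by rewrite !mulf_neq0 ?natr_neq0 // multinomial_gt0.
pose w (ab : 'I_B * 'I_C) := K^-1 * ((x ^+ m i1) ^- ab.1 * (y ^+ m i2) ^- ab.2).
pose p (ab : 'I_B * 'I_C) := triple i0 i1 alpha (x ^+ ab.1) (y ^+ ab.2).
rewrite -[X in (X * _)%N]card_ord -[X in (_ * X)%N]card_ord -card_prod.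
apply: (@sum_of_weighted_powers _ _ _ w p) => // [|m' dm'].
  by rewrite dhomogX.
have -> : \sum_ab w ab * 'X_[m'].@[p ab] = K^-1 * alpha ^+ m' i0 *
    ((\sum_(a < B) (x ^+ m' i1 / x ^+ m i1) ^+ a) *
     \sum_(b < C) (y ^+ m' i2 / y ^+ m i2) ^+ b).
  rewrite big_distrlr /= mulr_sumr.
  under [RHS]eq_bigr do rewrite mulr_sumr.
  rewrite pair_bigA /=; apply: eq_bigr => -[a b] _ /=.
  rewrite (meval_I3 u3) /p triple0 (triple1 u3) (triple2 u3) /w /= !expr_div_n.
  rewrite -!exprM ![(a * _)%N]mulnC ![(b * _)%N]mulnC.
  ring.
rewrite (sum_prim_root_powers _ _ px) (sum_prim_root_powers _ _ py) mcoeffX.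
have [<-|ne] := eqVneq m m'.
  rewrite !eqxx am mulr1 [_^-1 * _]mulrC mulrA -/K divff //.
have [->|a0] := eqVneq (alpha ^+ m' i0) 0; first by rewrite mulr0 mul0r mulr0.
case: eqP => [e1|]; last by rewrite !(mul0r, mulr0).
case: eqP => [e2|]; last by rewrite !(mul0r, mulr0).
by case/eqP: ne; rewrite (uniq_m m').
Qed.

Lemma sorted_exponents (m : 'X_{1..3}) : exists i0 i1 i2 : 'I_3,
  [/\ uniq [:: i0; i1; i2], (m i0 <= m i1)%N & (m i1 <= m i2)%N].
Proof.
pose le := relpre (m : 'I_3 -> nat) leq.
have tot : total le by move=> i j; apply: leq_total.
have := sort_sorted tot (enum 'I_3); have := sort_uniq le (enum 'I_3).
rewrite enum_uniq; have := size_sort le (enum 'I_3); rewrite size_enum_ord.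
case: (sort _ _) => [|i0 [|i1 [|i2 [|]]]] //= _ u /and3P [l1 l2 _].
by exists i0, i1, i2.
Qed.

Definition max_rank_value d : nat :=
  (if odd d then ((d + 1) %/ 2) ^ 2 else (d %/ 2) * (d %/ 2 + 1))%N.

Lemma mul_le_max_rank_value d b c : (b + c <= d.+1)%N -> (b * c <= max_rank_value d)%N.
Proof.
move=> le; have : (4 * (b * c) <= d.+1 ^ 2)%N.
  by apply: leq_trans (nat_AGM2 b c) _; rewrite leq_sqr.
rewrite /max_rank_value -(odd_double_half d) {le}.
rewrite oddD odd_double addbF oddb; case: (odd d); move: (d./2) => h; rewrite -!mulnn /=.
  have -> : ((1 + h.*2 + 1) %/ 2 = h.+1)%N by lia.
  by nia.
have -> : ((0 + h.*2) %/ 2 = h)%N by lia.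
by nia.
Qed.

Lemma max_rank_value_split d : (2 < d)%N -> exists b c,
  [/\ (b + c).+1 = d & max_rank_value d = b.+1 * c.+1]%N.
Proof.
move=> d2; exists (d.-1 %/ 2)%N, (d.-1 - d.-1 %/ 2)%N; split; first by lia.
rewrite /max_rank_value -(odd_double_half d) in d2 *.
rewrite oddD odd_double addbF oddb; case: (odd d) d2; move: (d./2) => h d2.
  have -> : ((1 + h.*2 + 1) %/ 2 = h.+1)%N by lia.
  have -> : ((true + h.*2).-1 %/ 2 = h)%N by lia.
  by have -> : ((true + h.*2).-1 - h = h)%N by lia.
have -> : ((0 + h.*2) %/ 2 = h)%N by lia.
have -> : ((false + h.*2).-1 %/ 2 = h.-1)%N by lia.
have -> : ((false + h.*2).-1 - h.-1 = h)%N by lia.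
by move: d2; case: h => [|h] d2 //=; lia.
Qed.

(** Let m i0 be the least exponent.  If it is positive, take B and C one more
    than the other two exponents: an exponent congruent to m i modulo m i + 1 but
    distinct from it is at least 2 m i + 1, too large for the degree.  If it is
    zero, take alpha = 0, B = 1 and C = m i2 + 1 for the largest exponent m i2. *)
Lemma rk_monomial_le (m : 'X_{1..3}) : (2 < mdeg m)%N ->
  (rk (mdeg m) ('X_[m] : {mpoly k[3]}) <= max_rank_value (mdeg m))%N.
Proof.
move=> dm; have dm0 : (0 < mdeg m)%N by apply: leq_trans dm.
have [i0 [i1 [i2 [u3 l01 l12]]]] := sorted_exponents m.
have e := mdeg_I3 u3 m.
have [m0|m0] := posnP (m i0).
  apply: (@leq_trans (1 * (m i2).+1)); last first.
    apply: leq_trans (mul_le_max_rank_value (b := 2) (c := (mdeg m).-1) _); last by lia.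
    by lia.
  apply: rk_leq.
  apply: (monomial_sum_of_powers u3 (alpha := 0)) => //; first by rewrite m0.
  move=> m' e' a0 _ e2; have z0 : m' i0 = 0%N.
    by apply/eqP; apply: contraNT a0; rewrite -lt0n => lt; rewrite expr0n gtn_eqF.
  move: e' e2; rewrite e (mdeg_I3 u3 m') m0 z0 !add0n => e' e2.
  have e2' : m' i2 = m i2.
    move: e2; rewrite [in RHS]modn_small // => e2.
    have : (m' i2 <= m i1 + m i2)%N by lia.
    move=> le; have := divn_eq (m' i2) (m i2).+1; rewrite e2.
    case: (m' i2 %/ _)%N => [|q]; first by [].
    by move=> h; exfalso; move: h le l12; nia.
  by apply: (eq_I3 u3) => //; [rewrite z0 m0 | lia].
apply: (@leq_trans ((m i1).+1 * (m i2).+1)); last first.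
  by apply: mul_le_max_rank_value; lia.
apply: rk_leq.
apply: (monomial_sum_of_powers u3 (alpha := 1)) => //; first by rewrite expr1n.
move=> m' e' _ e1 e2; move: e'; rewrite e (mdeg_I3 u3 m') => e'.
have large q r : (q %% r.+1 = r %% r.+1 -> q <> r -> r.*2.+1 <= q)%N.
  rewrite [in RHS]modn_small // => eq nqr; have := divn_eq q r.+1; rewrite eq.
  by case: (q %/ _)%N => [|q'] h; move: nqr; nia.
have e1' : m' i1 = m i1.
  case: (m' i1 =P m i1) => // /(large _ _ e1).
  by case: (m' i2 =P m i2) => [|/(large _ _ e2)]; lia.
have e2' : m' i2 = m i2 by case: (m' i2 =P m i2) => // /(large _ _ e2); lia.
by apply: (eq_I3 u3) => //; lia.
Qed.

(** The maximum is reached at x y^b z^c with b and c as close as possible. *)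
Lemma max_monomial_rkE d : (2 < d)%N -> max_monomial_rk k d = max_rank_value d.
Proof.
move=> d2; apply/eqP; rewrite eqn_leq; apply/andP; split.
  apply/bigmax_leqP => -[m /= /eqP dm] _.
  by have := rk_monomial_le (m := m); rewrite dm; apply.
have [b [c [dbc ->]]] := max_rank_value_split d2.
pose o i : 'I_3 := inord i.
have u3 : uniq [:: o 0%N; o 1%N; o 2].
  by rewrite /= !inE -!val_eqE /= !inordK.
pose m := mnm3 (o 0%N) (o 1%N) 1 b c.
have dm : mdeg m = d by rewrite (mdeg_I3 u3) !(mnm3E u3) -dbc.
have ltm : (mdeg m < d.+1)%N by rewrite dm.
have eqm : mdeg (BMultinom ltm) == d by rewrite /= dm.
pose M : monomial d := Sub (BMultinom ltm) eqm.
apply: leq_trans (leq_bigmax M) => /=.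
have := @rank_monomial_ge _ _ _ u3 k k_char0 m; rewrite !(mnm3E u3); apply=> //.
(* This monomial is a sum of some number of powers: with B and C larger than
   the degree, congruent exponents are equal. *)
rewrite dm; have hm : sum_of_powers d ('X_[m] : {mpoly k[3]}) (d.+1 * d.+1).
  rewrite -dm; apply: (monomial_sum_of_powers u3 (alpha := 1)); rewrite ?dm ?expr1n //.
    by apply: leq_trans d2.
  move=> m' e' _ e1 e2.
  have : mdeg m' = mdeg m by rewrite dm.
  rewrite !(mdeg_I3 u3).
  move: e1 e2; have := mdeg_I3 u3 m'; have := mdeg_I3 u3 m; rewrite dm e' => h h'.
  rewrite !modn_small; try lia.
  by move=> e1 e2 e0; apply: (eq_I3 u3) => //; lia.
exact: rkP hm.
Qed.

End MonomialRank.

(** * Dominant polynomial maps and algebraic dependence *)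

Lemma mderiv_mpolyXU n (R : nzRingType) (i j : 'I_n) :
  'X_j^`M(i) = (j == i)%:R :> {mpoly R[n]}.
Proof.
rewrite mderivX mnm1E; case: eqP => [->|_]; last by rewrite scale0r.
have -> : (U_(i) - U_(i))%MM = 0%MM :> 'X_{1..n}.
  by apply/mnmP=> l; rewrite mnmBE subnn mnm0E.
by rewrite mpolyX0 scale1r.
Qed.

Section ChainRule.
Variables (k : comNzRingType) (S : comNzRingType) (iota : {rmorphism k -> S}).
Variable D : {additive S -> S}.
Hypothesis DM : forall a b, D (a * b) = D a * b + a * D b.
Hypothesis D_const : forall c, D (iota c) = 0.

Lemma derivation1 : D 1 = 0.
Proof. by rewrite -(rmorph1 iota) D_const. Qed.

(** For an arbitrary derivation D of S over k: both partial derivatives of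
    polynomials in several variables and the derivative of univariate polynomials
    are used as D.  The identity is stable under products and holds for the
    variables. *)
Lemma mmap_chain_rule n (h : 'I_n -> S) (P : {mpoly k[n]}) :
  D (mmap iota h P) = \sum_i mmap iota h P^`M(i) * D (h i).
Proof.
pose chain P := D (mmap iota h P) = \sum_i mmap iota h P^`M(i) * D (h i).
have chainM P1 P2 : chain P1 -> chain P2 -> chain (P1 * P2).
  rewrite /chain => e1 e2; rewrite rmorphM DM e1 e2 mulr_suml mulr_sumr -big_split /=.
  by apply: eq_bigr => i _; rewrite mderivM rmorphD !rmorphM /=; ring.
have chainX i : chain 'X_i.
  rewrite /chain mmapX mmap1U (bigD1 i) //= big1 ?addr0 => [|j ne].
    by rewrite mderiv_mpolyXU eqxx rmorph1 mul1r.
  by rewrite mderiv_mpolyXU eq_sym (negPf ne) rmorph0 mul0r.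
have chainXm (N : nat) m : mdeg m = N -> chain 'X_[m].
  elim: N m => [|N IHN] m dm.
    move/eqP: dm; rewrite mdeg_eq0 => /eqP ->.
    rewrite /chain mpolyX0 rmorph1 derivation1 big1 // => i _.
    by rewrite -mpolyC1 mderivC rmorph0 mul0r.
  have [j mj] : exists j, m j != 0%N by apply: mdeg_neq0_ex; rewrite dm.
  rewrite -(@submK _ U_(j) m) ?lep1mP // mpolyXD; apply: chainM => //.
  by apply: IHN; rewrite mdeg_subU // dm.
rewrite -/(chain P); elim/mpolyind: P => [|c m P _ _ IHP].
  by rewrite /chain rmorph0 raddf0 big1 // => i _; rewrite mderiv0 rmorph0 mul0r.
rewrite /chain rmorphD raddfD IHP /= mmapZ DM D_const mul0r add0r (chainXm _ _ erefl).
rewrite mulr_sumr -big_split; apply: eq_bigr => i _ /=.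
by rewrite mderivD mderivZ rmorphD /= mmapZ mulrDl mulrA.
Qed.

End ChainRule.

Section Dominance.
Variable k : fieldType.
Hypothesis k_char0 : [pchar k] =i pred0.

(** Differentiation lowers the degree, and in characteristic zero a
    polynomial whose partial derivatives all vanish is constant. *)
Lemma mpoly_deriv_ind n (K : {mpoly k[n]} -> Prop) :
  (forall P i, K P -> K P^`M(i)) -> (forall c, K c%:MP -> c = 0) ->
  forall P, K P -> P = 0.
Proof.
move=> Kd Kc P.
have [N hN] : exists N, forall m, (N <= mdeg m)%N -> P@_m = 0.
  exists (msize P) => m le; apply: memN_msupp_eq0.
  exact: msize_mdeg_ge.
elim: N P hN => [|N IHN] P hN KP.
  by apply/mpolyP=> m; rewrite mcoeff0 hN.
have dP i : P^`M(i) = 0.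
  apply: IHN; last exact: Kd.
  by move=> m le; rewrite mcoeff_deriv hN ?mul0rn // mdegD mdeg1 addn1.
have eP : P = (P@_0)%:MP.
  apply/mpolyP=> m; rewrite mcoeffC.
  have [->|m0] := eqVneq m 0%MM; first by rewrite mulr1.
  have [|i mi] := @mdeg_neq0_ex _ m; first by rewrite mdeg_eq0.
  have := congr1 (mcoeff (m - U_(i))) (dP i).
  rewrite mcoeff_deriv mcoeff0 submK ?lep1mP // mulr0 => /eqP.
  rewrite -mulr_natr mulf_eq0 => /orP [/eqP //|].
  by move/pcharf0P: k_char0 => ->.
by rewrite eP (Kc (P@_0)) ?mpolyC0 // -eP.
Qed.

(** Vanishing everywhere is inherited by partial derivatives, since the
    restriction to a line parallel to an axis is a univariate polynomial with
    infinitely many roots. *)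
Lemma mpoly_vanishing_eq0 n (P : {mpoly k[n]}) : (forall v, P.@[v] = 0) -> P = 0.
Proof.
move: P; apply: mpoly_deriv_ind => [P i hP v|c]; last first.
  by move/(_ (fun=> 0)); rewrite mevalC.
pose h j : {poly k} := (v j)%:P + (i == j)%:R *: 'X.
have mmap_h (Q : {mpoly k[n]}) t :
    (mmap (@polyC k) h Q).[t] = Q.@[fun j => v j + (i == j)%:R * t].
  rewrite mevalE /mmap horner_sum; apply: eq_bigr => m _.
  rewrite hornerM hornerC horner_prod; congr (_ * _).
  by apply: eq_bigr => j _; rewrite horner_exp /h !hornerE.
have mmap0 : mmap (@polyC k) h P = 0.
  have [//|nz] := eqVneq (mmap (@polyC k) h P) 0.
  have [T [sT _]] := uniq_nonroots k_char0 1 nz; case: T sT => [|t T] //= _ /andP [rt _].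
  by case/negP: rt; rewrite rootE mmap_h hP.
have : (mmap (@polyC k) h P)^`() = \sum_j mmap (@polyC k) h P^`M(j) * (h j)^`().
  exact: (@mmap_chain_rule k {poly k} (@polyC k) (@deriv k) (@derivM k) (@derivC k)).
rewrite mmap0 deriv0 (bigD1 i) //= big1 => [|j ne]; last first.
  by rewrite derivD derivC add0r derivZ eq_sym (negPf ne) scale0r mulr0.
rewrite derivD derivC add0r derivZ derivX eqxx scale1r mulr1 addr0 => /esym e.
have := congr1 (fun q : {poly k} => q.[0]) e; rewrite horner0 mmap_h => <-.
by apply: meval_eq => j; rewrite mulr0 addr0.
Qed.

Lemma meval_map_mpolyC_mx m n q (K : 'M[k]_(m, n)) v :
  map_mx (meval v) (map_mx (@mpolyC q k) K) = K.
Proof. by apply/matrixP=> i j; rewrite !mxE /= mevalC. Qed.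

(** If P o phi = 0, the chain rule says that the row of the (dP/dy_i) o phi is
    killed by the Jacobian matrix J of phi.  At v the rows of J are independent, so
    J(v) K = 1 for a constant matrix K, and det (J K) is a nonzero polynomial;
    hence (dP/dy_i) o phi = 0 for all i, and [mpoly_deriv_ind] applies. *)
Lemma dominant_of_jacobian n q (phi : n.-tuple {mpoly k[q]}) (v : 'I_q -> k) :
  (forall l : 'I_n -> k,
     (forall j, \sum_i l i * ((tnth phi i)^`M(j)).@[v] = 0) -> forall i, l i = 0) ->
  forall P : {mpoly k[n]}, P \mPo phi = 0 -> P = 0.
Proof.
move=> inj_J; pose J := \matrix_(i < n, j < q) (tnth phi i)^`M(j).
have [K JK] : exists K, map_mx (meval v) J *m K = 1%:M.
  apply/row_freeP; rewrite -kermx_eq0; apply/rowV0P => l /sub_kermxP lJ.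
  apply/rowP=> i; rewrite mxE; apply: (inj_J (l 0)) => j.
  have := congr1 (fun M : 'rV_q => M 0 j) lJ; rewrite !mxE => e; rewrite -[RHS]e.
  by apply: eq_bigr => i' _; rewrite !mxE.
set A := J *m map_mx (@mpolyC q k) K.
have dA : \det A != 0.
  apply: contraTneq (oner_neq0 k) => d0; rewrite negbK -(det1 k n) -JK.
  rewrite -[K](meval_map_mpolyC_mx K v) -map_mxM det_map_mx.
  by rewrite -/A d0 rmorph0.
apply: mpoly_deriv_ind => [P i hP|c]; last first.
  by rewrite comp_mpolyC => /eqP; rewrite mpolyC_eq0 => /eqP.
pose w := \row_e (P^`M(e) \mPo phi).
have wJ : w *m J = 0.
  apply/rowP=> j; rewrite !mxE.
  have : (P \mPo phi)^`M(j) = \sum_e (P^`M(e) \mPo phi) * (tnth phi e)^`M(j).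
    exact: (@mmap_chain_rule k {mpoly k[q]} (@mpolyC q k) (mderiv j)
             (@mderivM q k j) (@mderivC q k j)).
  rewrite hP mderiv0 => e0; rewrite [RHS]e0.
  by apply: eq_bigr => e _; rewrite !mxE.
have : w *m A *m \adj A = 0 by rewrite mulmxA wJ !mul0mx.
rewrite -mulmxA mul_mx_adj mul_mx_scalar => /rowP /(_ i); rewrite !mxE => /eqP.
by rewrite mulf_eq0 (negPf dA) => /eqP.
Qed.

End Dominance.

Section AlgebraicDependence.
Variable k : fieldType.

Lemma msize_mul_le n (P Q : {mpoly k[n]}) a b :
  (msize P <= a.+1)%N -> (msize Q <= b.+1)%N -> (msize (P * Q) <= (a + b).+1)%N.
Proof.
move=> hP hQ; have [->|P0] := eqVneq P 0; first by rewrite mul0r msize0.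
have [->|Q0] := eqVneq Q 0; first by rewrite mulr0 msize0.
by rewrite msizeM // -subn1 leq_subLR add1n -addnS -addSn leq_add.
Qed.

Lemma msize_comp_monomial_le n q (phi : n.-tuple {mpoly k[q]}) e D (m : 'X_{1..n}) :
  (forall i, (msize (tnth phi i) <= e.+1)%N) -> (forall i, (m i <= D)%N) ->
  (msize ('X_[m] \mPo phi) <= (n * (D * e)).+1)%N.
Proof.
move=> he hD; rewrite comp_mpolyX -[n in (n * _)%N]card_ord -sum_nat_const.
elim/big_rec2: _ => [|i d P _ IH]; first by rewrite msize1.
apply: msize_mul_le IH.
apply: (@leq_trans (m i * e).+1); last by rewrite ltnS leq_mul2r hD orbT.
elim: (m i) => [|a IHa]; first by rewrite expr0 msize1.
by rewrite exprS mulSn; apply: msize_mul_le.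
Qed.

(** Counting: the monomials in n letters with all exponents at most D number
    (D + 1)^n, while their images have exponents less than E, linear in D, in q
    variables, hence lie in a space of dimension E^q.  For D large the first number
    exceeds the second because n > q. *)
Lemma algebraic_dependence n q (phi : n.-tuple {mpoly k[q]}) : (q < n)%N ->
  exists2 P : {mpoly k[n]}, P != 0 & P \mPo phi = 0.
Proof.
move=> lt_qn.
pose e := \max_i msize (tnth phi i).
have he i : (msize (tnth phi i) <= e.+1)%N by apply: leqW; apply: leq_bigmax.
pose D := ((n * e).+1 ^ q)%N.
pose E := (D.+1 * (n * e).+1)%N.
pose mon r N (a : {ffun 'I_r -> 'I_N}) : 'X_{1..r} := [multinom a i : nat | i < r].
pose A (a : {ffun 'I_n -> 'I_D.+1}) (b : {ffun 'I_q -> 'I_E}) :=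
  ('X_[mon _ _ a] \mPo phi)@_(mon _ _ b).
have [|f [a fa] fA] := @linear_system_nontrivial _ _ _ A.
  rewrite !card_ffun !card_ord /E expnMn -/D mulnC.
  apply: (@leq_trans (D.+1 ^ q.+1)); last by rewrite leq_exp2l // ltnS lt0n expn_eq0.
  by rewrite expnS ltn_pmul2r ?expn_gt0.
exists (\sum_a f a *: 'X_[mon _ _ a]).
  apply: contraNneq fa => P0; have := congr1 (mcoeff (mon _ _ a)) P0.
  rewrite mcoeff0 raddf_sum /= (bigD1 a) //= mcoeffZ mcoeffX eqxx mulr1 big1 ?addr0.
    by move->.
  move=> a' ne; rewrite mcoeffZ mcoeffX; case: eqP => [ea|]; last by rewrite mulr0.
  case/eqP: ne; apply/ffunP=> i; apply: val_inj.
  by have := congr1 (fun m : 'X_{1..n} => m i) ea; rewrite !mnmE.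
rewrite raddf_sum /=; under eq_bigr do rewrite comp_mpolyZ.
apply/mpolyP=> b; rewrite mcoeff0 raddf_sum /=.
have [/forallP hb|/forallPn [j]] := boolP [forall j, b j < E]%N.
  have -> : b = mon _ _ [ffun j => Ordinal (hb j)].
    by apply/mnmP=> j; rewrite mnmE ffunE.
  rewrite -[RHS](fA [ffun j => Ordinal (hb j)]).
  by apply: eq_bigr => a' _; rewrite mcoeffZ.
rewrite -leqNgt => bj; rewrite big1 // => a' _; rewrite mcoeffZ memN_msupp_eq0 ?mulr0 //.
apply: msize_mdeg_ge; apply: leq_trans (msize_comp_monomial_le (D := D) he _) _.
  by move=> i; rewrite mnmE -ltnS.
apply: (@leq_trans E); first by rewrite /E; nia.
by apply: leq_trans bj _; rewrite mdegE (bigD1 j) //= leq_addr.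
Qed.

End AlgebraicDependence.

(** * Bounds for the generic rank *)

Section Dehomogenization.
Variables (k : fieldType) (i0 i1 i2 : 'I_3).
Hypothesis k_char0 : [pchar k] =i pred0.
Hypothesis u3 : uniq [:: i0; i1; i2].
Implicit Types (G : {mpoly k[3]}) (q : k * k).

Definition affine_point q : 'I_3 -> k := triple i0 i1 q.1 q.2 1.

Definition affine_coord : 'I_3 -> {poly {poly k}} := triple i0 i1 'X ('X)%:P 1.

Definition dehom G : {poly {poly k}} := mmap (polyC \o polyC) affine_coord G.

Lemma dehomE G :
  dehom G = \sum_(m <- msupp G) (G@_m *: 'X^(m i1))%:P * 'X^(m i0).
Proof.
apply: eq_bigr => m _; rewrite /mmap1 (big_I3 u3) /= /affine_coord.
rewrite triple0 (triple1 u3) (triple2 u3) expr1n mulr1 /= -mul_polyC polyCM.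
by rewrite -polyC_exp mulrCA mulrC.
Qed.

Lemma evalxy_dehom G q : evalxy (dehom G) q = G.@[affine_point q].
Proof.
rewrite dehomE mevalE /evalxy !horner_sum; apply: eq_bigr => m _.
rewrite (big_I3 u3) /= /affine_point triple0 (triple1 u3) (triple2 u3) expr1n mulr1.
by rewrite !(hornerM, hornerZ, hornerC, horner_exp, hornerX) mulrA mulrAC.
Qed.

Lemma deriv_dehom G : (dehom G)^`() = dehom G^`M(i0).
Proof.
have -> : (dehom G)^`() = \sum_i dehom G^`M(i) * (affine_coord i)^`().
  apply: (@mmap_chain_rule k {poly {poly k}} (polyC \o polyC) (@deriv _) (@derivM _)).
  by move=> c; apply: derivC.
rewrite (big_I3 u3) /= /affine_coord triple0 (triple1 u3) (triple2 u3) !derivC derivX.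
by rewrite !mulr0 mulr1 !addr0.
Qed.

Lemma deriv_y_dehom G : deriv_y (dehom G) = dehom G^`M(i1).
Proof.
have -> : deriv_y (dehom G) = \sum_i dehom G^`M(i) * deriv_y (affine_coord i).
  apply: (@mmap_chain_rule k {poly {poly k}} (polyC \o polyC) (map_poly (@deriv k))).
    exact: deriv_yM.
  by move=> c; rewrite /= map_polyC /= derivC.
rewrite (big_I3 u3) /= /affine_coord triple0 (triple1 u3) (triple2 u3) /deriv_y.
rewrite !map_polyC /= derivC derivX mulr1 mulr0 addr0.
suff -> : map_poly (@deriv k) 'X = 0 by rewrite mulr0 add0r.
apply/polyP=> i; rewrite coef_map coefX coef0 /=.
by case: (i == 1%N); rewrite /= -?polyC1 derivC.
Qed.

(** Euler's identity, from which a form with vanishing gradient at a point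
    vanishes there. *)
Lemma euler_identity n (d : nat) (F : {mpoly k[n]}) : F \is d.-homog ->
  \sum_i F^`M(i) * 'X_i = F *+ d.
Proof.
move=> hF; apply/mpolyP=> m; rewrite mcoeffMn raddf_sum /=.
have [<-|nm] := eqVneq (mdeg m) d; last first.
  rewrite (dhomog_nemf_coeff hF nm) mul0rn big1 // => i _.
  rewrite mcoeffMU; case: eqP => // /eqP mi; rewrite mcoeff_deriv submK ?lep1mP //.
  by rewrite (dhomog_nemf_coeff hF nm) mul0rn.
rewrite mdegE -sumrMnr; apply: eq_bigr => i _; rewrite mcoeffMU.
case: eqP => [->|/eqP mi]; first by rewrite mulr0n.
rewrite mcoeff_deriv submK ?lep1mP // mnmBE mnm1E eqxx subn1 prednK //.
by rewrite lt0n.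
Qed.

Lemma tdeg_dehom d G : G \is d.-homog -> tdeg_lt d.+1 (dehom G).
Proof.
move=> hG a; rewrite dehomE coef_sum; apply: leq_trans (size_sum _ _ _) _.
rewrite big_seq; apply/bigmax_leqP_seq => m mG _.
rewrite coefCM coefXn; case: eqP => [->|_]; last by rewrite mulr0 size_poly0.
rewrite mulr1; apply: leq_trans (size_scale_leq _ _) _; rewrite size_polyXn.
by rewrite -(dhomog_mf hG mG) /= (mdeg_I3 u3); lia.
Qed.

Lemma dehom_eq0 d G : G \is d.-homog -> dehom G = 0 -> G = 0.
Proof.
move=> hG; rewrite dehomE => G0; apply/mpolyP=> m; rewrite mcoeff0.
have [mG|] := boolP (m \in msupp G); last exact: memN_msupp_eq0.
have := congr1 (fun f : {poly {poly k}} => f`_(m i0)`_(m i1)) G0.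
rewrite !coef0 !coef_sum (bigD1_seq m) //= coefCM coefXn eqxx mulr1.
rewrite coefZ coefXn eqxx mulr1 big_seq_cond big1 ?addr0 // => m' /andP [m'G ne].
rewrite coefCM coefXn; case: eqP => [e0|]; last by rewrite mulr0 coef0.
rewrite mulr1 coefZ coefXn; case: eqP => [e1|]; last by rewrite mulr0.
case/eqP: ne; apply: (eq_I3 u3) => //.
have := dhomog_mf hG mG; have := dhomog_mf hG m'G; rewrite /= !(mdeg_I3 u3); lia.
Qed.

(** Forms in three variables are curves in the affine plane once the last
    variable is set to 1.  A common zero of the partial derivatives of a form is a
    singular point of the curve by Euler's identity, d being nonzero in k. *)
Lemma singular_form_eq0 d (Q : seq (k * k)) G : (0 < d)%N ->
  (forall f, tdeg_lt d.+1 f -> {in Q, forall q, singular_at f q} -> f = 0) ->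
  G \is d.-homog ->
  (forall q j, q \in Q -> G^`M(j).@[affine_point q] = 0) -> G = 0.
Proof.
move=> d0 hQ hG sing; apply: (dehom_eq0 hG); apply: hQ (tdeg_dehom hG) _ => q qQ.
split; rewrite ?deriv_dehom ?deriv_y_dehom evalxy_dehom ?sing //.
have := congr1 (meval (affine_point q)) (euler_identity hG).
rewrite mevalMn raddf_sum /= big1 => [/esym/eqP|i _]; last first.
  by rewrite mevalM sing // mul0r.
rewrite -mulr_natr mulf_eq0 => /orP [/eqP //|].
by move/pcharf0P: k_char0 => ->; rewrite eqn0Ngt d0.
Qed.

End Dehomogenization.

Section MomentMap.
Variable k : fieldType.
Hypothesis k_char0 : [pchar k] =i pred0.
Variable d : nat.

Local Notation N := #|{: monomial d}|.

Definition expo (e : 'I_N) : 'X_{1..3} := val (enum_val e).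

Lemma mdeg_expo e : mdeg (expo e) = d.
Proof. by apply/eqP; apply: (valP (enum_val e)). Qed.

Lemma expo_inj : injective expo.
Proof. by move=> e e' h; apply: enum_val_inj; do 2 apply: val_inj. Qed.

Lemma expoP m : mdeg m = d -> exists e, expo e = m.
Proof.
move=> dm; have ltm : (mdeg m < d.+1)%N by rewrite dm.
have eqm : mdeg (BMultinom ltm) == d by rewrite /= dm.
pose M : monomial d := Sub (BMultinom ltm) eqm.
by exists (enum_rank M); rewrite /expo enum_rankK.
Qed.

Lemma card_monomial : N = 'C(d + 2, 2).
Proof.
have -> : 'C(d + 2, 2) = 'C(d + 2, d) by rewrite -bin_sub ?leq_addl // addnK.
rewrite -(size_basis 2 d).
have -> : N = size (map expo (enum 'I_N)) by rewrite size_map size_enum_ord.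
apply/perm_size/uniq_perm.
- by rewrite map_inj_uniq ?enum_uniq //; apply: expo_inj.
- exact: uniq_basis.
move=> m; rewrite -basis_cover; apply/mapP/eqP => [[e _ ->]|/expoP [e <-]].
  exact: mdeg_expo.
by exists e; rewrite ?mem_enum.
Qed.

Definition form_of_coords (y : 'I_N -> k) : {mpoly k[3]} :=
  \sum_e y e *: 'X_[expo e].

Lemma form_of_coords_homog y : form_of_coords y \is d.-homog.
Proof.
by apply: rpred_sum => e _; rewrite dhomogZ // dhomogX; apply/eqP/mdeg_expo.
Qed.

Lemma mcoeff_form_of_coords y e : (form_of_coords y)@_(expo e) = y e.
Proof.
rewrite raddf_sum (bigD1 e) //= mcoeffZ mcoeffX eqxx mulr1 big1 ?addr0 // => e' ne.
by rewrite mcoeffZ mcoeffX (inj_eq expo_inj) (negPf ne) mulr0.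
Qed.

Lemma coords_form_of_coords y : coords (form_of_coords y) =1 y.
Proof. exact: mcoeff_form_of_coords. Qed.

Definition point_vars s (i : 'I_s) : 3.-tuple {mpoly k[s * 3]} :=
  [tuple 'X_(mxvec_index i j) | j < 3].

(** The 3 s variables are the coordinates of s points; the values are the
    coefficients of the sum of the d-th powers of the corresponding linear forms. *)
Definition moment_map s : N.-tuple {mpoly k[s * 3]} :=
  [tuple (multinomial d (expo e))%:R *: \sum_(i < s) ('X_[expo e] \mPo point_vars i)
  | e < N].

Lemma meval_moment_map s v e :
  (tnth (moment_map s) e).@[v] =
  (multinomial d (expo e))%:R * \sum_i 'X_[expo e].@[fun j => v (mxvec_index i j)].
Proof.
rewrite tnth_mktuple mevalZ raddf_sum; congr (_ * _); apply: eq_bigr => i _ /=.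
rewrite comp_mpoly_meval; apply: meval_eq => j.
by rewrite tnth_mktuple mevalXU.
Qed.

Lemma sum_of_powers_coords s F : F \is d.-homog ->
  sum_of_powers d F s <->
  exists v, forall e, coords F e = (tnth (moment_map s) e).@[v].
Proof.
move=> hF; rewrite (sum_of_powersP _ hF); split=> [[p hp]|[v hv]].
  exists (fun x => mxvec (\matrix_(i < s, j < 3) p i j) 0 x) => e.
  rewrite meval_moment_map /coords -/(expo e) hp ?mdeg_expo //; congr (_ * _).
  by apply: eq_bigr => i _; apply: meval_eq => j; rewrite mxvecE mxE.
exists (fun i j => v (mxvec_index i j)) => m /expoP [e <-].
by rewrite -meval_moment_map -hv.
Qed.

Lemma mxvec_index_inj s n (i i' : 'I_s) (j j' : 'I_n) :
  (mxvec_index i j == mxvec_index i' j') = (i == i') && (j == j').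
Proof. by rewrite (inj_eq (@cast_ord_inj _ _ _)) (inj_eq enum_rank_inj). Qed.

(** Only the i-th point depends on its j-th coordinate. *)
Lemma mderiv_moment_map s (i : 'I_s) j v e :
  ((tnth (moment_map s) e)^`M(mxvec_index i j)).@[v] =
  (multinomial d (expo e))%:R *
    'X_[expo e]^`M(j).@[fun j => v (mxvec_index i j)].
Proof.
rewrite tnth_mktuple mderivZ mevalZ (raddf_sum (mderiv _)) (raddf_sum (meval v)) /=.
congr (_ * _).
have chain i' : ('X_[expo e] \mPo point_vars i')^`M(mxvec_index i j) =
    \sum_j' ('X_[expo e]^`M(j') \mPo point_vars i') *
      (tnth (point_vars i') j')^`M(mxvec_index i j).
  exact: (@mmap_chain_rule k {mpoly k[s * 3]} (@mpolyC _ k) (mderiv (mxvec_index i j))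
             (@mderivM _ k _) (@mderivC _ k _)).
rewrite (bigD1 i) //= [X in _ + X]big1 ?addr0 => [|i' ne]; rewrite chain.
  rewrite (bigD1 j) //= big1 ?addr0 => [|j' ne].
    rewrite tnth_mktuple mderiv_mpolyXU eqxx mulr1 comp_mpoly_meval.
    by apply: meval_eq => j'; rewrite tnth_mktuple mevalXU.
  by rewrite tnth_mktuple mderiv_mpolyXU mxvec_index_inj (negPf ne) andbF mulr0.
rewrite big1 ?meval0 // => j' _.
by rewrite tnth_mktuple mderiv_mpolyXU mxvec_index_inj (negPf ne) mulr0.
Qed.

(** A linear relation between the rows of the Jacobian matrix is a form of
    degree d whose gradient vanishes at all the points; for the points of
    [no_singular_curve], there is no such form but 0. *)
Lemma moment_map_dominant : (0 < d)%N ->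
  exists2 s, (6 * s <= d.+2 * d.+3)%N &
    forall P : {mpoly k[N]}, P \mPo moment_map s = 0 -> P = 0.
Proof.
move=> d0; have [Q sQ hQ] := no_singular_curve k_char0 d.+1.
exists (size Q) => //.
pose o i : 'I_3 := inord i.
have u3 : uniq [:: o 0%N; o 1%N; o 2] by rewrite /= !inE -!val_eqE /= !inordK.
pose pt := affine_point (k := k) (o 0%N) (o 1%N).
pose v x := mxvec (\matrix_(i < size Q, j < 3) pt (nth (0, 0) Q i) j) 0 x.
apply: (dominant_of_jacobian k_char0 (v := v)) => l hl e.
pose y e' := l e' * (multinomial d (expo e'))%:R.
suff G0 : form_of_coords y = 0.
  have := mcoeff_form_of_coords y e; rewrite G0 mcoeff0 => /esym/eqP.
  rewrite mulf_eq0 => /orP [/eqP //|]; move/pcharf0P: k_char0 => ->.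
  by rewrite eqn0Ngt multinomial_gt0 // mdeg_expo.
apply: (singular_form_eq0 k_char0 u3 d0 hQ (form_of_coords_homog y)) => q j qQ.
have iq : (index q Q < size Q)%N by rewrite index_mem.
rewrite -[RHS](hl (mxvec_index (Ordinal iq) j)).
rewrite (raddf_sum (mderiv j)) (raddf_sum (meval _)) /=.
apply: eq_bigr => e' _; rewrite mderiv_moment_map mderivZ mevalZ -mulrA.
congr (_ * (_ * _)); apply: meval_eq => j'.
by rewrite /v mxvecE mxE /= nth_index.
Qed.

(** By [moment_map_dominant], sums of s powers meet every nonempty open set.
    One of them in U shows r <= s.  If 3 r were less than the number of
    coefficients, a nonzero polynomial T would vanish on the coefficients of all
    sums of r powers; but U contains a form F with T nonzero at F which is a
    sum of powers, hence a sum of rk F = r of them. *)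
Lemma generic_rk_bounds r : (0 < d)%N -> is_generic_rk k d r ->
  ('C(d + 2, 2) <= r * 3)%N /\ (6 * r <= d.+2 * d.+3)%N.
Proof.
move=> d0 [U [[I hU] [F0 hF0 /(hU _ hF0) [P IP PF0]] hr]].
have [s ls dom] := moment_map_dominant d0.
have reach T : T != 0 :> {mpoly k[N]} -> exists F, [/\ F \is d.-homog,
    T.@[coords F] != 0 & sum_of_powers d F s].
  move=> T0; have [v hv] : exists v, (T \mPo moment_map s).@[v] != 0.
    apply: contrapT => h; case/eqP: T0; apply: dom.
    apply: (mpoly_vanishing_eq0 k_char0) => v.
    by apply: contrapT => /eqP hv; apply: h; exists v.
  rewrite comp_mpoly_meval in hv.
  pose y e := (tnth (moment_map s) e).@[v].
  exists (form_of_coords y); split; first exact: form_of_coords_homog.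
    by rewrite (meval_eq _ (coords_form_of_coords y)).
  apply/sum_of_powers_coords; first exact: form_of_coords_homog.
  by exists v; apply: coords_form_of_coords.
have P0 : P != 0 by apply: contraNneq PF0 => ->; rewrite meval0.
split.
  rewrite -card_monomial leqNgt; apply/negP => lt.
  have [T T0 hT] := algebraic_dependence (moment_map r) lt.
  have [F [hF PTF sF]] := reach (P * T) (mulf_neq0 P0 T0).
  move: PTF; rewrite mevalM mulf_eq0 negb_or => /andP [PF /eqP []].
  have UF : U F by apply/hU => //; exists P.
  have := rkP sF; rewrite (hr F hF UF) => /(sum_of_powers_coords _ hF) [v hv].
  by rewrite (meval_eq _ hv) -comp_mpoly_meval hT meval0.
have [F [hF PF sF]] := reach P P0.
have UF : U F by apply/hU => //; exists P.
by apply: leq_trans ls; rewrite leq_mul2l -(hr F hF UF) rk_leq ?orbT.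
Qed.

End MomentMap.

End WaringRank.

From mathcomp Require Import all_classical all_reals all_analysis.
Import numFieldNormedType.Exports.
Local Open Scope classical_set_scope.
Local Open Scope ring_scope.

(** * Asymptotics *)

Module Asymptotics.
Import Order.TTheory GRing.Theory Num.Theory WaringRank.
Set Implicit Arguments.
Unset Strict Implicit.
Unset Printing Implicit Defensive.

Lemma max_rank_value_bounds d :
  (d * (d + 2) <= 4 * max_rank_value d <= (d + 1) * (d + 1))%N.
Proof.
rewrite /max_rank_value -(odd_double_half d).
rewrite oddD odd_double addbF oddb; case: (odd d); move: (d./2) => h.
  have -> : ((true + h.*2 + 1) %/ 2 = h.+1)%N by lia.
  by rewrite -mulnn; lia.
have -> : ((false + h.*2) %/ 2 = h)%N by lia.
by lia.
Qed.

Lemma mul2_bin_add2 d : (2 * 'C(d + 2, 2) = (d + 1) * (d + 2))%N.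
Proof. by rewrite addn2 -(mul_bin_diag d.+2 1) bin1 addn1 mulnC. Qed.

(** The bounds make the ratio lie between 1 - 3 / (d + 1) and 1. *)
Lemma ratio_cvg (R : realType) (m g : nat -> R) :
  (\forall d \near \oo, d%:R * (d%:R + 2) <= 4 * m d <= (d%:R + 1) * (d%:R + 1)) ->
  (\forall d \near \oo,
     (d%:R + 1) * (d%:R + 2) <= 6 * g d <= (d%:R + 2) * (d%:R + 3)) ->
  m d / (3 / 2 * g d) @[d --> \oo] --> (1 : R).
Proof.
move=> hm hg.
apply: (@squeeze_cvgr _ _ _ _ (fun d => 1 - 3 * harmonic d) (fun=> 1)); last 2 first.
- rewrite -[X in _ --> X]subr0; apply: cvgB; first exact: cvg_cst.
  rewrite -[X in _ --> X](mulr0 3); apply: cvgM; first exact: cvg_cst.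
  exact: cvg_harmonic.
- exact: cvg_cst.
near=> d.
have /andP [m1 m2] : d%:R * (d%:R + 2) <= 4 * m d <= (d%:R + 1) * (d%:R + 1).
  by near: d.
have /andP [g1 g2] : (d%:R + 1) * (d%:R + 2) <= 6 * g d <= (d%:R + 2) * (d%:R + 3).
  by near: d.
have x0 : 0 <= d%:R :> R by apply: ler0n.
rewrite /harmonic /= -[d.+1%:R]natr1.
move: (d%:R : R) (m d) (g d) x0 m1 m2 g1 g2 => x M G x0 m1 m2 g1 g2.
have G0 : 0 < 3 / 2 * G by nra.
rewrite ler_pdivlMr // ler_pdivrMr // mul1r; apply/andP; split; last by nra.
have y1 : 0 < x + 1 by lra.
have -> : 1 - 3 * (x + 1)^-1 = (x - 2) / (x + 1) by field; rewrite gt_eqF.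
rewrite [leLHS]mulrAC ler_pdivrMr //.
have [x2|x2] := lerP x 2; first by nra.
have gx : (x - 2) * (6 * G) <= (x - 2) * ((x + 2) * (x + 3)).
  by rewrite ler_wpM2l // subr_ge0 ltW.
have mx : x * (x + 2) * (x + 1) <= 4 * M * (x + 1) by rewrite ler_wpM2r // ltW.
by nra.
Unshelve. all: by end_near. Qed.

Lemma max_monomial_rk_ratio_cvg (k : closedFieldType)
    (k_char0 : [pchar k] =i pred0) (R : realType) (g : nat -> R) :
  (\forall d \near \oo,
     (d%:R + 1) * (d%:R + 2) <= 6 * g d <= (d%:R + 2) * (d%:R + 3)) ->
  (max_monomial_rk k d)%:R / (3 / 2 * g d) @[d --> \oo] --> (1 : R).
Proof.
apply: (ratio_cvg (m := fun d => (max_monomial_rk k d)%:R)).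
apply: filterS (nbhs_infty_gt 2) => d d2; rewrite max_monomial_rkE //.
by have := max_rank_value_bounds d; rewrite -!(ler_nat R) !natrM !natrD.
Qed.

Lemma generic_rk_growth (k : closedFieldType) (k_char0 : [pchar k] =i pred0)
    (R : realType) d r : (0 < d)%N -> is_generic_rk k d r ->
  (d%:R + 1) * (d%:R + 2) <= 6 * (r%:R : R) <= (d%:R + 2) * (d%:R + 3).
Proof.
move=> d0 /(generic_rk_bounds k_char0 d0) [lo hi].
have c2 := mul2_bin_add2 d.
have : ((d + 1) * (d + 2) <= 6 * r <= (d + 2) * (d + 3))%N by lia.
by rewrite -!(ler_nat R) !natrM !natrD.
Qed.

Lemma expected_rk_growth (R : realType) d : (0 < d)%N ->
  (d%:R + 1) * (d%:R + 2) <= 6 * ((Num.ceil ('C(d + 2, 2)%:R / 3 : R))%:~R : R)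
    <= (d%:R + 2) * (d%:R + 3).
Proof.
rewrite -(ler_nat R) => d0.
have /(congr1 (fun n => n%:R : R)) := mul2_bin_add2 d.
rewrite !natrM !natrD; move: ('C(_, _)%:R : R) => c c2.
have lo := ceil_ge (c / 3); have := ceilB1_lt (c / 3); rewrite intrD => hi.
apply/andP; split; nra.
Qed.

End Asymptotics.

Theorem proposition4p1 (k : closedFieldType) (k_char0 : [pchar k] =i pred0)
    (R : realType) :
  [/\ forall d : nat, (2 < d)%N ->
        max_monomial_rk k d =
          (if odd d then ((d + 1) %/ 2) ^ 2 else (d %/ 2) * (d %/ 2 + 1))%N,
      forall g : nat -> nat,
        (\forall d \near \oo, is_generic_rk k d (g d)) ->
        (max_monomial_rk k d)%:R / (3 / 2 * (g d)%:R) @[d --> \oo] --> (1 : R)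
    & (max_monomial_rk k d)%:R
        / (3 / 2 * (Num.ceil ('C(d + 2, 2)%:R / 3 : R))%:~R)
        @[d --> \oo] --> (1 : R)].
Proof.
split=> [d|g hg|].
- exact: WaringRank.max_monomial_rkE.
- apply: Asymptotics.max_monomial_rk_ratio_cvg => //.
  apply: filterS2 (nbhs_infty_gt 0) hg => d; exact: Asymptotics.generic_rk_growth.
- apply: Asymptotics.max_monomial_rk_ratio_cvg => //.
  apply: filterS (nbhs_infty_gt 0) => d; exact: Asymptotics.expected_rk_growth.
Qed.
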